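(* Let $\beta>1$, $\gamma>0$ and $\top>0$. There exist constants $c_1,c_2,c_3>0$, depending only on $\beta,\gamma,\top$, such that the following holds. Let $X$ be a random variable with $\mathbb{E}[\exp(\gamma|X|^\beta)]<\top<\infty$ and let $\alpha\in\mathbb{R}$. Let $l:\mathbb{R}\to\mathbb{R}$ be non-decreasing and suppose there exist $K,k>0$ such that $l$ is $K$-Lipschitz and $l(x_2)\ge l(x_1)+k(x_2-x_1)$ whenever $x_2\ge x_1$. Then, for every $\epsilon>0$ and $n\ge1$, $$\mathbb{P}\left(|\xi_{n,\alpha}-S_\alpha(X)|>\epsilon\right)\le c_1\left[\exp\left(-c_2n\left(\tfrac{k\epsilon}{K}\right)^2\right)\mathbf 1\left\{\epsilon\le\tfrac Kk\right\}+\exp\left(-c_3n\left(\tfrac{k\epsilon}{K}\right)^\beta\right)\mathbf 1\left\{\epsilon>\tfrac Kk\right\}\right].$$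
   Context: The utility-based shortfall risk (UBSR) with utility function $l$ and level $\alpha$ is $S_\alpha(X)=\inf\{\xi\in\mathbb{R}:\mathbb{E}[l(X-\xi)]\le\alpha\}$. Given i.i.d. samples $X_1,\dots,X_n$ from the distribution of $X$, $\xi_{n,\alpha}$ denotes the solution of the problem: minimize $\xi\in\mathbb{R}$ subject to $\frac1n\sum_{i=1}^nl(X_i-\xi)\le\alpha$. *)

(* Defs.v *)
From mathcomp Require Import all_boot all_order all_algebra.
From mathcomp Require Import all_classical all_reals all_analysis.

Set Implicit Arguments.
Unset Strict Implicit.
Unset Printing Implicit Defensive.

Import Order.TTheory GRing.Theory Num.Theory.
Import numFieldNormedType.Exports.

Local Open Scope classical_set_scope.
Local Open Scope ring_scope.

(* [inf] is the infimum in R, with value 0 on sets that are empty or not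
   bounded below; neither occurs when [l] is Lipschitz with slopes bounded
   below by a positive constant and [X] is integrable. *)
Definition ubsr (R : realType) (d : measure_display) (T : measurableType d)
    (P : probability T R) (l : R -> R) (alpha : R) (X : T -> R) : R :=
  inf [set xi : R | ('E_P[fun w => l (X w - xi)%R] <= alpha%:E)%E].

Definition saa_feasible (R : realType) (l : R -> R) (alpha : R) (n : nat)
    (x : 'I_n -> R) : set R :=
  [set xi | n%:R^-1 * (\sum_(i < n) l (x i - xi)) <= alpha].

Definition saa_solutions (R : realType) (l : R -> R) (alpha : R) (n : nat)
    (x : 'I_n -> R) : set R :=
  [set xi | saa_feasible l alpha x xi /\
            forall xi', saa_feasible l alpha x xi' -> xi <= xi'].

(* The minimizer of the sample problem. A minimizer is unique when it exists,
   and it exists for [0 < n] and [l] as in the comment on [ubsr]; the default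
   value 0 is then irrelevant. *)
Definition saa_ubsr (R : realType) (l : R -> R) (alpha : R) (n : nat)
    (x : 'I_n -> R) : R :=
  xget 0 (saa_solutions l alpha x).

Definition mutually_independent (R : realType) (d : measure_display)
    (T : measurableType d) (P : probability T R) (I : finType)
    (Xs : I -> {RV P >-> R}) : Prop :=
  forall (J : {set I}) (A : I -> set R), (forall i, measurable (A i)) ->
    P (\bigcap_(i in [set` J]) (Xs i @^-1` A i)) =
    (\prod_(i in J) P (Xs i @^-1` A i))%E.

(* Laws are compared on measurable sets only: the values that a measure takes
   on non-measurable sets carry no meaning. *)
Definition same_distribution (R : realType) (d : measure_display)
    (T : measurableType d) (P : probability T R) (X Y : {RV P >-> R}) : Prop :=
  forall A : set R, measurable A -> distribution P X A = distribution P Y A.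

Definition iid_samples (R : realType) (d : measure_display)
    (T : measurableType d) (P : probability T R) (X : {RV P >-> R}) (n : nat)
    (Xs : 'I_n -> {RV P >-> R}) : Prop :=
  mutually_independent Xs /\ forall i, same_distribution (Xs i) X.

(* Main.v *)
Require Import Defs.
From HB Require Import structures.
From mathcomp Require Import all_boot all_order all_algebra finmap.
From mathcomp Require Import all_classical all_reals all_analysis.
From mathcomp Require Import measurable_realfun ring lra.
Import Order.TTheory GRing.Theory Num.Theory.
Import numFieldNormedType.Exports.
Import HBNNSimple.
Local Open Scope classical_set_scope.
Local Open Scope ring_scope.

(** Both [xi |-> E l(X - xi)] and its empirical version decrease with slopes
between [k] and [K], so each takes the value [alpha] exactly once, at
[r = S_alpha(X)] and at the sample solution respectively. If the two roots
differ by more than [eps], the sample mean of the centered variables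
[Z i = (l(X i - r) - alpha) / K] has absolute value at least
[t = k eps / K]; moreover [|Z i| <= |X i| + E|X|].

For [t] below a threshold [t0] depending only on [beta], [gamma], [top], the
bound [E exp(s Z) <= exp(A s^2)] for [|s| <= 1] and Chernoff's method with
[s = t / 2A] give [2 exp(- n t^2 / 4A)]. For [t > t0], the mean of the [|X i|]
is at least [t / 2], hence by convexity the mean of the [|X i|^beta] is at
least [(t / 2)^beta], and Chernoff's bound applied to [gamma |X|^beta] gives
[exp(- c n t^beta)]. Between [1] and [t0] the two rates are comparable. *)

(** * Chernoff's bound for i.i.d. samples *)

(** Summing over a finite type of values lets [bigA_distr_bigA] expand a product of such sums. *)
Lemma nnsfun_sum_indic (d : measure_display) (T : measurableType d)
    (R : realType) (g : {nnsfun T >-> R}) (x : T) :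
  g x = \sum_(y : fset_set (range g)) val y * \1_(g @^-1` [set val y]) x.
Proof.
rewrite fimfunE fsbig_finite//=.
by rewrite big_seq_fsetE.
Qed.

Section iid.
Context {R : realType} {d : measure_display} {T : measurableType d}.
Variables (P : probability T R) (X : {RV P >-> R}) (n : nat).
Variable Xs : 'I_n -> {RV P >-> R}.
Hypothesis iidX : iid_samples X Xs.

(** The product of sums expands into a sum over assignments [phi] of values to the samples. Each
    term carries the indicator of one intersection of preimages, to which the product rule for
    events applies; the resulting sum then factors back. *)
Lemma iid_integral_prod_nnsfun (g : {nnsfun R >-> R}) :
  (\int[P]_w (\prod_(i < n) g (Xs i w))%:E = (\int[P]_w (g (X w))%:E) ^+ n)%E.
Proof.
pose s : finType := fset_set (range g).
pose A (y : s) := g @^-1` [set val y].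
have mA y : measurable (A y) by exact: measurable_sfunP.
pose p y := fine (P (X @^-1` A y)).
have mXA (Y : {RV P >-> R}) y : measurable (Y @^-1` A y).
  by rewrite -[X in measurable X]setTI; exact: measurable_funP.
have Pp i y : P (Xs i @^-1` A y) = (p y)%:E.
  rewrite /p fineK ?fin_num_measure//.
  exact: (iidX.2 i (A y) (mA y)).
have s0 (y : s) : 0 <= val y.
  by move: (fsvalP y); rewrite in_fset_set // => /set_mem[x _ /= <-].
have mi (B : set T) (c : R) : measurable B ->
    measurable_fun setT ((fun w => (c * \1_B w)%:E) : T -> \bar R).
  move=> mB; apply/measurable_EFinP; apply: measurable_funM => //.
have iE (B : set T) (c : R) : 0 <= c -> measurable B ->
    (\int[P]_w (c * \1_B w)%:E = c%:E * P B)%E.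
  move=> c0 mB; under eq_integral do rewrite EFinM.
  rewrite ge0_integralZl//; last exact/measurable_EFinP.
  by rewrite integral_indic// setIT.
have -> : (\int[P]_w (g (X w))%:E = (\sum_(y : s) val y * p y)%:E)%E.
  under eq_integral do rewrite nnsfun_sum_indic -sumEFin.
  rewrite ge0_integral_sum//; last 2 first.
  - by move=> y; apply: (mi (X @^-1` A y)).
  - by move=> y w _; rewrite lee_fin mulr_ge0.
  rewrite -sumEFin; apply: eq_bigr => y _.
  rewrite (iE (X @^-1` A y))// EFinM /p fineK// fin_num_measure//.
pose B (phi : {ffun 'I_n -> s}) :=
  \bigcap_(i in [set` [set: 'I_n]%SET]) (Xs i @^-1` A (phi i)).
have mB phi : measurable (B phi).
  by apply: fin_bigcap_measurable => //= i _; exact: mXA.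
have PB phi : (P (B phi) = (\prod_(i < n) p (phi i))%:E)%E.
  rewrite /B (iidX.1 _ (fun i => A (phi i)))//= -prodEFin.
  by apply: eq_big => i /=; [rewrite finset.in_setT|rewrite Pp].
have -> : (fun w => (\prod_(i < n) g (Xs i w))%:E) =
    (fun w => (\sum_(phi : {ffun 'I_n -> s})
       ((\prod_(i < n) val (phi i)) * \1_(B phi) w)%:E)%E).
  apply/funext => w; rewrite sumEFin; congr EFin.
  under eq_bigr do rewrite nnsfun_sum_indic.
  rewrite bigA_distr_bigA; apply: eq_bigr => phi _.
  rewrite big_split/=; congr (_ * _).
  rewrite indicE; case: (boolP (w \in B phi)) => [|/negP wB].
    rewrite inE => wB; rewrite big1// => i _.
    by rewrite indicE mem_set//; apply: (wB i); rewrite /= finset.in_setT.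
  have [i wi] : exists i, ~ (Xs i @^-1` A (phi i)) w.
    by apply/existsNP => h; apply: wB; rewrite inE => i _; exact: h.
  rewrite (bigD1 i)//= indicE memNset ?mul0r//.
rewrite ge0_integral_sum//; last 2 first.
- by move=> phi; apply: mi.
- by move=> phi w _; rewrite lee_fin mulr_ge0// prodr_ge0.
under eq_bigr do rewrite iE ?prodr_ge0// PB -EFinM -big_split/=.
rewrite sumEFin -(bigA_distr_bigA (fun _ y => val y * p y))/= prodr_const card_ord.
by rewrite EFin_expe.
Qed.

(* Independence is only assumed as a product rule for events, so it is first
   used on simple functions; monotone convergence does the rest. *)
Lemma iid_expectation_prod_le (f : R -> R) (C : R) :
  measurable_fun setT f -> (forall x, 0 <= f x) ->
  ('E_P[f \o X] <= C%:E)%E ->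
  ('E_P[fun w => (\prod_(i < n) f (Xs i w))%R] <= (C ^+ n)%:E)%E.
Proof.
move=> mf f0; rewrite !expectation.unlock => fC.
have mEf : measurable_fun setT (EFin \o f) by exact/measurable_EFinP.
pose g := nnsfun_approx measurableT mEf.
have g_nd x : {homo g^~ x : m m' / (m <= m')%N >-> m <= m'}.
  by move=> m m' mm'; exact/lefP/nd_nnsfun_approx.
have g_cvg x : g m x @[m --> \oo] --> f x.
  have /fine_cvgP[_] := @cvg_nnsfun_approx _ _ _ _ measurableT _ mEf
    (fun y _ => f0 y) x Logic.I.
  exact.
have mp m : measurable_fun setT (fun w => (\prod_(i < n) g m (Xs i w))%:E).
  apply/measurable_EFinP/measurable_prod => i _.
  exact: measurableT_comp.
have prod_cvg w :
    limn (fun m => (\prod_(i < n) g m (Xs i w))%:E) = (\prod_(i < n) f (Xs i w))%:E.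
  apply/cvg_lim => //; apply: cvg_EFin; first exact: nearW.
  by apply: cvg_big => [|i _]; [exact: mul_continuous|exact: g_cvg].
under eq_integral do rewrite -prod_cvg.
have := @cvg_monotone_convergence _ _ _ P setT measurableT _ mp.
move=> /(_ _ _)/cvg_lim <- //; last 2 first.
- by move=> m w _; rewrite lee_fin prodr_ge0.
- move=> w _ m m' mm'; rewrite lee_fin ler_prod// => i _.
  by rewrite fun_ge0 g_nd.
apply: lime_le.
  apply: ereal_nondecreasing_is_cvgn => m m' mm'.
  apply: ge0_le_integral => //.
  - by move=> w _; rewrite lee_fin prodr_ge0.
  - move=> w _; rewrite lee_fin ler_prod// => i _.
    by rewrite fun_ge0 g_nd.
(* Each simple approximation lies below [f], so its integral is at most [C] and the bound holds
   before passing to the limit. *)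
apply: nearW => m; rewrite iid_integral_prod_nnsfun.
have mgX : measurable_fun setT (fun w => (g m (X w))%:E).
  by apply/measurable_EFinP; exact: measurableT_comp.
have gC : (\int[P]_w (g m (X w))%:E <= C%:E)%E.
  apply: le_trans fC; apply: ge0_le_integral => //.
  - by move=> w _; rewrite lee_fin.
  - by apply/measurable_EFinP; exact: measurableT_comp.
  - move=> w _; rewrite lee_fin /= -(cvg_lim _ (g_cvg (X w)))//.
    by apply: nondecreasing_cvgn_le; [exact: g_nd|apply/cvg_ex; exists (f (X w))].
have g0 : (0 <= \int[P]_w (g m (X w))%:E)%E.
  by apply: integral_ge0 => w _; rewrite lee_fin.
have gfin : (\int[P]_w (g m (X w))%:E)%E \is a fin_num.
  by rewrite ge0_fin_numE// (le_lt_trans gC)// ltry.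
move: gC g0; rewrite -(fineK gfin) -EFin_expe !lee_fin => gC g0.
by rewrite lerXn2r// nnegrE// (le_trans g0).
Qed.

(** The exponential parameter is absorbed into [h], so [chernoff] is applied at parameter 1; the
    exponential of the sum is then a product over the samples. *)
Lemma iid_chernoff (h : R -> R) (C s : R) :
  measurable_fun setT h ->
  ('E_P[fun w => expR (h (X w))] <= C%:E)%E ->
  (P [set w | (s <= \sum_(i < n) h (Xs i w))%R] <=
     (expR (- s) * C ^+ n)%:E)%E.
Proof.
move=> mh hC.
have mS : measurable_fun setT (fun w => \sum_(i < n) h (Xs i w)).
  by apply: measurable_sum => i; exact: measurableT_comp.
pose S : {RV P >-> R} := HB.pack (fun w => \sum_(i < n) h (Xs i w))
  (isMeasurableFun.Build _ _ _ _ _ mS).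
apply: (le_trans (chernoff S s ltr01)).
rewrite mul1r EFinM muleC lee_pmul2l ?lte_fin ?expR_gt0//.
have := @iid_expectation_prod_le (expR \o h) C.
rewrite /mmt_gen_fun/= => /(_ _ _ hC); under eq_fun do rewrite -expR_sum.
suff -> : expR \o 1 \o* S = fun w => expR (\sum_(i < n) h (Xs i w)).
  by apply; [exact: measurableT_comp|move=> x; exact: expR_ge0].
by apply/funext => w /=; rewrite mulr1.
Qed.
End iid.

(** * Elementary inequalities *)

Lemma lipschitz_continuous {R : realType} (f : R -> R) (K : R) :
  (forall x y, `|f x - f y| <= K * `|x - y|) -> continuous f.
Proof.
move=> fK x; apply/cvgrPdist_lt => e e0; near=> y.
(* No sign is assumed for [K], hence the positive constant |K| + 1. *)
have K1 : 0 < `|K| + 1 by rewrite ltr_wpDl.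
have fxy : `|f x - f y| <= (`|K| + 1) * `|x - y|.
  by rewrite (le_trans (fK x y))// ler_wpM2r// (le_trans (ler_norm K))// lerDl.
apply: (le_lt_trans fxy); rewrite mulrC -ltr_pdivlMr//.
near: y; apply: cvgr_dist_lt => //; exact: divr_gt0.
Unshelve. all: by end_near. Qed.

(** * Decreasing functions with controlled slope *)

Section slope.
Context {R : realType}.
Variables (g : R -> R) (k K : R).
Hypothesis k0 : 0 < k.
Hypothesis gk : forall x y : R, x <= y -> k * (y - x) <= g x - g y.

Lemma slope_le (r x : R) : (g x <= g r) = (r <= x).
Proof.
apply/idP/idP => [|rx].
  apply: contraTT; rewrite -!ltNge => xr.
  have : 0 < k * (r - x) by rewrite mulr_gt0 ?subr_gt0.
  by have := gk _ _ (ltW xr); lra.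
have : 0 <= k * (x - r) by rewrite mulr_ge0 ?subr_ge0// ltW.
by have := gk _ _ rx; lra.
Qed.

Lemma slope_lt (r x : R) : (g r < g x) = (x < r).
Proof. by rewrite !ltNge slope_le. Qed.

Lemma slope_root (a : R) :
  (forall x y : R, x <= y -> g x - g y <= K * (y - x)) -> exists r, g r = a.
Proof.
move=> gK.
have gc : continuous g.
  apply: (@lipschitz_continuous _ _ K) => x y.
  wlog xy : x y / x <= y => [h|].
    by have [/h//|/ltW/h] := leP x y; rewrite distrC (distrC y).
  rewrite (distrC x) !ger0_norm ?subr_ge0//; first exact: gK.
  by rewrite slope_le.
(* Falling at rate at least [k], [g] covers the gap |g(0) - a| within distance [M] of 0 on either
   side, so its values at the ends of [-M, M] bracket [a]. *)
pose M := `|g 0 - a| / k.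
have M0 : 0 <= M by rewrite divr_ge0// ltW.
have kM : k * M = `|g 0 - a| by rewrite /M mulrC divfK// gt_eqF.
have gM : g M <= a.
  by have := gk _ _ M0; have := ler_norm (g 0 - a); rewrite subr0 kM; lra.
have gNM : a <= g (- M).
  have := gk _ _ (_ : - M <= 0); rewrite oppr_le0 => /(_ M0).
  by have := ler_norm (a - g 0); rewrite distrC sub0r opprK kM; lra.
have NMM : - M <= M by lra.
have [||r _ gr] := @IVT R g (- M) M a NMM; last by exists r.
  exact: continuous_subspaceT.
by rewrite ge_min le_max gM gNM orbT.
Qed.
End slope.

(** Since e^x - 1 <= x e^x = x + x (e^x - 1), it suffices to bound x (e^x - 1) by x^2 e^|x|: for x
    >= 0 by the same inequality, for x <= 0 by e^x - 1 >= x. *)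
Lemma expR_le1Dx_sqr {R : realType} (x : R) :
  expR x <= 1 + x + x ^+ 2 * expR `|x|.
Proof.
(* [1 - x <= expR (- x)], multiplied by [expR x] *)
have h1 : expR x - 1 <= x * expR x.
  have := expR_ge1Dx (- x); rewrite expRN => /(ler_wpM2r (expR_ge0 x)).
  by rewrite mulVf ?gt_eqF ?expR_gt0//; lra.
have h2 : 1 + x <= expR x := expR_ge1Dx x.
have [x0|/ltW x0] := leP 0 x.
  have : x * (expR x - 1) <= x * (x * expR x) by rewrite ler_wpM2l.
  by rewrite ger0_norm// expr2; lra.
have : x * (expR x - 1) <= x ^+ 2.
  by rewrite expr2 ler_wnM2l//; lra.
have : x ^+ 2 <= x ^+ 2 * expR `|x|.
  by rewrite ler_peMr ?sqr_ge0// -expR0 ler_expR.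
lra.
Qed.

Lemma sqr_le_expR {R : realType} (x : R) : 0 <= x -> x ^+ 2 <= 4 * expR x.
Proof.
move=> x0; have := expR_ge1Dx (x / 2) => h.
have : (x / 2) ^+ 2 <= expR (x / 2) ^+ 2.
  rewrite lerXn2r// ?nnegrE ?expR_ge0 ?divr_ge0//.
  by apply: le_trans h; lra.
by rewrite -expRM_natl -[2%:R * _]mulrC divfK//; lra.
Qed.

(** Serves to dominate exp(2|X|) by a multiple of exp(c |X|^b) with a factor depending on [b] and
    [c] only. *)
Lemma linear_le_powR {R : realType} (b c : R) : 1 < b -> 0 < c ->
  exists2 C, 0 < C & forall x, 0 <= x -> 2 * x <= c * x `^ b + C.
Proof.
move=> b1 c0; pose x0 := (2 / c) `^ (b - 1)^-1.
have c2 : 0 < 2 / c by rewrite divr_gt0.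
have x0_gt0 : 0 < x0 by rewrite powR_gt0.
exists (2 * x0); first by rewrite mulr_gt0.
move=> x x_ge0; have [xx0|x0x] := leP x x0.
  have : 0 <= c * x `^ b by rewrite mulr_ge0 ?powR_ge0// ltW.
  lra.
have xgt0 : 0 < x := lt_trans x0_gt0 x0x.
have -> : x `^ b = x * x `^ (b - 1).
  by rewrite -{2}[x]powRr1// -powRD ?(gt_eqF xgt0) ?implybT//; congr powR; ring.
have : 2 / c <= x `^ (b - 1).
  have -> : 2 / c = x0 `^ (b - 1).
    by rewrite -powRrM mulVf ?powRr1 ?ltW// gt_eqF ?subr_gt0.
  by rewrite ge0_ler_powR ?nnegrE ?ltW ?subr_gt0.
rewrite ler_pdivrMr// => h.
have : 2 * x <= c * (x * x `^ (b - 1)).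
  by rewrite mulrCA mulrC ler_wpM2l// mulrC.
lra.
Qed.

Lemma powR_ge_tangent {R : realType} (b s x : R) : 1 < b -> 0 < s -> 0 <= x ->
  s `^ b * (1 + b * (x / s - 1)) <= x `^ b.
Proof.
move=> b1 s0 x0; have b0 : 0 < b by apply: lt_trans b1.
pose q := b / (b - 1).
have q0 : 0 < q by rewrite divr_gt0// subr_gt0.
have qE : q^-1 = 1 - b^-1 by rewrite /q invf_div mulrBl divff ?gt_eqF// mul1r.
have bq : b^-1 + q^-1 = 1 by rewrite qE; ring.
have u0 : 0 <= x / s by rewrite divr_ge0// ltW.
(* Young's inequality against 1 is Bernoulli's inequality for [x / s]. *)
have := conjugate_powR u0 (ler01 : 0 <= 1 :> R) b0 q0 bq.
rewrite powR1 mulr1 mul1r qE => h.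
have -> : x `^ b = s `^ b * (x / s) `^ b.
  by rewrite -(powRM _ (ltW s0) u0) mulrC divfK// gt_eqF.
rewrite ler_wpM2l ?powR_ge0//.
have : b * (x / s) <= b * ((x / s) `^ b / b + (1 - b^-1)) by rewrite ler_wpM2l// ltW.
have -> : b * ((x / s) `^ b / b + (1 - b^-1)) = (x / s) `^ b + b - 1.
  by field; rewrite gt_eqF.
lra.
Qed.

(** Jensen's inequality by summing tangents at [s]: the mean is at least [s] and the slope is
    positive, so the linear terms add up to a nonnegative number. *)
Lemma powR_sum_ge {R : realType} (b s : R) (n : nat) (x : 'I_n -> R) :
  1 < b -> 0 < s -> (forall i, 0 <= x i) -> n%:R * s <= \sum_(i < n) x i ->
  n%:R * s `^ b <= \sum_(i < n) x i `^ b.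
Proof.
move=> b1 s0 x0 ns.
apply: (@le_trans _ _ (\sum_(i < n) s `^ b * (1 + b * (x i / s - 1)))); last first.
  by apply: ler_sum => i _; exact: powR_ge_tangent.
rewrite -mulr_sumr mulrC ler_wpM2l ?powR_ge0//.
rewrite big_split/= sumr_const card_ord -[leLHS]addr0 lerD2l.
rewrite -mulr_sumr mulr_ge0//; first by rewrite (le_trans _ (ltW b1)).
by rewrite sumrB sumr_const card_ord -mulr_suml subr_ge0 ler_pdivlMr.
Qed.

(** * The expected loss and its centering *)

Lemma klipschitzP {R : realType} (l : R -> R) (K : R) :
  K.-lipschitz l -> forall x y, `|l x - l y| <= K * `|x - y|.
Proof. by move=> lK x y; exact: (lK (x, y)). Qed.

Section exponential_moment.
Context {R : realType} {d : measure_display} {T : measurableType d}.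
Variables (P : probability T R) (X : {RV P >-> R}) (b c top : R).
Hypothesis Xtop : ('E_P[fun w => expR (c * `|X w| `^ b)%R] < top%:E)%E.

Let mpow : measurable_fun setT (fun w => c * `|X w| `^ b).
Proof.
apply: measurable_funM => //.
apply: (measurableT_comp (measurable_powR _)); exact: measurableT_comp.
Qed.

(** Both moment bounds below reduce to this pointwise domination, which keeps their constants free
    of the law of [X]. *)
Lemma exp_moment_dominated (Y : T -> R) (a : R) : 0 <= a ->
  measurable_fun setT Y -> (forall w, 0 <= Y w <= a * expR (c * `|X w| `^ b)) ->
  P.-integrable setT (EFin \o Y) /\ \int[P]_w Y w <= a * top.
Proof.
move=> a0 mY Ya.
have mE : measurable_fun setT (fun w => (expR (c * `|X w| `^ b))%:E).
  by apply/measurable_EFinP; exact: measurableT_comp.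
have Y0 w : 0 <= Y w by have /andP[] := Ya w.
have IY : (\int[P]_w (Y w)%:E <= (a * top)%:E)%E.
  apply: (@le_trans _ _ (\int[P]_w (a%:E * (expR (c * `|X w| `^ b))%:E))%E).
    apply: ge0_le_integral => //.
    - by move=> w _; rewrite lee_fin.
    - exact/measurable_EFinP.
    - exact: measurable_funeM.
    - by move=> w _; rewrite -EFinM lee_fin; have /andP[] := Ya w.
  rewrite ge0_integralZl//.
  by rewrite EFinM lee_wpmul2l//; move: Xtop; rewrite expectation.unlock => /ltW.
have iY : P.-integrable setT (EFin \o Y).
  apply/integrableP; split; first exact/measurable_EFinP.
  apply: le_lt_trans (ltry (a * top)); apply: le_trans IY.
  apply: ge0_le_integral => //.
  - by do 2 apply: measurableT_comp => //.
  - exact/measurable_EFinP.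
  - by move=> w _; rewrite /= ger0_norm.
split=> //.
rewrite -lee_fin /Rintegral fineK//; exact: integrable_fin_num.
Qed.

Section shortfall.
Variable C : R.
Hypothesis XC : forall x, 0 <= x -> 2 * x <= c * x `^ b + C.

Let expR2_le w : expR (2 * `|X w|) <= expR C * expR (c * `|X w| `^ b).
Proof. by rewrite -expRD ler_expR addrC XC. Qed.

Lemma first_absolute_moment :
  P.-integrable setT (EFin \o (fun w => `|X w|)) /\
  \int[P]_w `|X w| <= expR C * top.
Proof.
apply: exp_moment_dominated; rewrite ?expR_ge0//; first exact: measurableT_comp.
move=> w; rewrite normr_ge0 (le_trans _ (expR2_le w))//.
have := expR_ge1Dx (2 * `|X w|); have := normr_ge0 (X w); lra.
Qed.

Let m := \int[P]_w `|X w|.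

(** Z^2 e^|Z| <= 4 e^(2|Z|) <= 4 e^(2m) e^(2|X|), and [XC] bounds e^(2|X|) by e^C exp(c |X|^b).
    Bounding [m] by [first_absolute_moment] removes the last dependence on the law. *)
Lemma sqr_expR_moment (Z : T -> R) :
  measurable_fun setT Z -> (forall w, `|Z w| <= `|X w| + m) ->
  P.-integrable setT (EFin \o (fun w => Z w ^+ 2 * expR `|Z w|)) /\
  \int[P]_w (Z w ^+ 2 * expR `|Z w|) <= 4 * expR (2 * (expR C * top) + C) * top.
Proof.
move=> mZ Zm; apply: exp_moment_dominated.
- by rewrite mulr_ge0 ?expR_ge0.
- apply: measurable_funM; first exact: measurable_funX.
  by do 2 apply: measurableT_comp => //.
- move=> w; rewrite mulr_ge0 ?expR_ge0 ?sqr_ge0//=.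
  have h : `|Z w| ^+ 2 <= 4 * expR `|Z w| by exact: sqr_le_expR.
  rewrite -real_normK ?num_real//.
  apply: (le_trans (ler_wpM2r (expR_ge0 _) h)).
  rewrite -!mulrA ler_pM2l// -!expRD ler_expR.
  have := Zm w; have := first_absolute_moment.2; rewrite -/m.
  have := XC _ (normr_ge0 (X w)); lra.
Qed.

Variables (l : R -> R) (k K : R).
Hypotheses (k0 : 0 < k) (K0 : 0 < K).
Hypothesis lK : forall x y, `|l x - l y| <= K * `|x - y|.
Hypothesis lk : forall x y : R, x <= y -> l x + k * (y - x) <= l y.

Let ml : measurable_fun setT l.
Proof. by apply: continuous_measurable_fun; exact: lipschitz_continuous lK. Qed.

Let mlX xi : measurable_fun setT (fun w => l (X w - xi)).
Proof. by apply: measurableT_comp => //; exact: measurable_funB. Qed.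

Let icst (a : R) : P.-integrable setT (EFin \o (fun=> a)).
Proof. exact: finite_measure_integrable_cst. Qed.

Let iKX a : P.-integrable setT (EFin \o (fun w => a + K * `|X w|)).
Proof.
apply: (@integrableD _ _ _ P setT _ (EFin \o (fun=> a))
  (EFin \o (fun w => K * `|X w|))) => //.
exact: (integrableZl _ K first_absolute_moment.1).
Qed.

Lemma integrable_loss xi : P.-integrable setT (EFin \o (fun w => l (X w - xi))).
Proof.
(* The Lipschitz bound between X - xi and -xi gives |l(X - xi)| <= |l(-xi)| + K |X|. *)
apply: le_integrable (iKX `|l (- xi)|) => //; first exact/measurable_EFinP.
move=> w _; rewrite /= lee_fin [leRHS]ger0_norm ?addr_ge0 ?mulr_ge0 ?(ltW K0)//.
have := lK (X w - xi) (- xi); rewrite opprK subrK.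
by have := ler_normD (l (X w - xi) - l (- xi)) (l (- xi)); rewrite subrK; lra.
Qed.

Definition mean_loss xi := \int[P]_w l (X w - xi).

Lemma mean_lossE xi : ('E_P[fun w => l (X w - xi)] = (mean_loss xi)%:E)%E.
Proof.
rewrite expectation.unlock /mean_loss /Rintegral fineK//.
exact: integrable_fin_num (integrable_loss xi).
Qed.

Let mean_lossB x y :
  mean_loss x - mean_loss y = \int[P]_w (l (X w - x) - l (X w - y)).
Proof. by rewrite RintegralB//; exact: integrable_loss. Qed.

Let intB x y : P.-integrable setT (EFin \o (fun w => l (X w - x) - l (X w - y))).
Proof.
exact: (@integrableB _ _ _ P setT _ _ _ (integrable_loss x) (integrable_loss y)).
Qed.

Let int_cst (a : R) : \int[P]_w a = a.
Proof. by rewrite Rintegral_cst//= probability_setT mulr1. Qed.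

Lemma mean_loss_lower x y : x <= y -> k * (y - x) <= mean_loss x - mean_loss y.
Proof.
move=> xy; rewrite mean_lossB -[leLHS]int_cst; apply: le_Rintegral => // w _.
have := @lk (X w - y) (X w - x); rewrite lerD2l lerN2 => /(_ xy); lra.
Qed.

Lemma mean_loss_upper x y : x <= y -> mean_loss x - mean_loss y <= K * (y - x).
Proof.
move=> xy; rewrite mean_lossB -[leRHS]int_cst; apply: le_Rintegral => // w _.
rewrite (le_trans (ler_norm _))// (le_trans (lK _ _))//.
have -> : X w - x - (X w - y) = y - x by ring.
by rewrite ger0_norm// subr_ge0.
Qed.

(** The deviation is the mean of l(x - r) - l(X - r), where [r] cancels in the Lipschitz bound,
    leaving K E|x - X|. *)
Lemma loss_deviation r x : `|l (x - r) - mean_loss r| <= K * (`|x| + m).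
Proof.
have iE : P.-integrable setT (EFin \o (fun w => l (x - r) - l (X w - r))).
  exact: (@integrableB _ _ _ P setT _ _ _ (icst _) (integrable_loss r)).
have -> : l (x - r) - mean_loss r = \int[P]_w (l (x - r) - l (X w - r)).
  by rewrite RintegralB ?int_cst//; exact: integrable_loss.
apply: (le_trans (le_normr_Rintegral _ iE)) => //.
have -> : K * (`|x| + m) = \int[P]_w (K * `|x| + K * `|X w|).
  rewrite RintegralD ?int_cst ?RintegralZl ?mulrDr//; first exact: first_absolute_moment.1.
  exact: (integrableZl _ K first_absolute_moment.1).
apply: le_Rintegral => //.
  exact: (integrable_abse iE).
move=> w _; rewrite (le_trans (lK _ _))// -mulrDr ler_pM2l//.
have -> : x - r - (X w - r) = x - X w by ring.
exact: ler_normB.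
Qed.

(** Strict decrease makes the feasible set the half-line from [r], so the default value of [inf]
    never arises. *)
Lemma ubsr_mean_loss r alpha : mean_loss r = alpha -> ubsr P l alpha X = r.
Proof.
move=> ra; rewrite /ubsr (_ : mkset _ = `[r, +oo[%classic).
  by rewrite inf_itv.
apply/seteqP; split => xi /=; rewrite in_itv/= andbT mean_lossE lee_fin -ra;
  by rewrite (slope_le _ _ k0 mean_loss_lower).
Qed.

Lemma mean_loss_root alpha : exists r, mean_loss r = alpha.
Proof. exact: (slope_root _ _ _ k0 mean_loss_lower _ mean_loss_upper). Qed.

(** Division by [K] gives a bound |x| + m free of [l], which makes the tail constants uniform in the
    loss. *)
Definition centered_loss r x := (l (x - r) - mean_loss r) / K.

Lemma measurable_centered_loss r : measurable_fun setT (centered_loss r).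
Proof.
apply: measurable_funM => //; apply: measurable_funB => //.
by apply: measurableT_comp => //; exact: measurable_funB.
Qed.

Lemma normr_centered_loss r x : `|centered_loss r x| <= `|x| + m.
Proof.
by rewrite normrM normfV (gtr0_norm K0) ler_pdivrMr// mulrC loss_deviation.
Qed.

Let iB r : P.-integrable setT (EFin \o (fun w => l (X w - r) - mean_loss r)).
Proof.
exact: (@integrableB _ _ _ P setT _ _ _ (integrable_loss r) (icst _)).
Qed.

Lemma integrable_centered_loss r :
  P.-integrable setT (EFin \o (centered_loss r \o X)).
Proof.
have := integrableZl measurableT K^-1 (iB r).
by apply: eq_integrable => // w _; rewrite /= /centered_loss mulrC.
Qed.

Lemma Rintegral_centered_loss r : \int[P]_w centered_loss r (X w) = 0.
Proof.
rewrite RintegralZr// RintegralB ?int_cst ?subrr ?mul0r//.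
exact: integrable_loss.
Qed.

End shortfall.
End exponential_moment.

(** * Tail bounds *)

(** In the bound of [expR_le1Dx_sqr] the linear term integrates to 0, and |lam| <= 1 allows e^|lam
    Z| to be replaced by e^|Z|. The inequality 1 + u <= e^u finishes. *)
Lemma centered_mgf_le {R : realType} {d : measure_display} {T : measurableType d}
    (P : probability T R) (Z : T -> R) (A lam : R) :
  P.-integrable setT (EFin \o Z) -> \int[P]_w Z w = 0 ->
  P.-integrable setT (EFin \o (fun w => Z w ^+ 2 * expR `|Z w|)) ->
  \int[P]_w (Z w ^+ 2 * expR `|Z w|) <= A -> `|lam| <= 1 ->
  ('E_P[fun w => expR (lam * Z w)%R] <= (expR (A * lam ^+ 2))%:E)%E.
Proof.
move=> iZ Z0 iZ2 ZA lam1.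
have mZ : measurable_fun setT Z by apply/measurable_EFinP; case/integrableP: iZ.
pose B w := Z w ^+ 2 * expR `|Z w|.
have i1 : P.-integrable setT (EFin \o (fun=> 1 : R)).
  exact: finite_measure_integrable_cst.
have ilZ : P.-integrable setT (EFin \o (fun w => lam * Z w)).
  exact: (integrableZl _ lam iZ).
have ilB : P.-integrable setT (EFin \o (fun w => lam ^+ 2 * B w)).
  exact: (integrableZl _ (lam ^+ 2) iZ2).
have i1Z : P.-integrable setT (EFin \o (fun w => 1 + lam * Z w)).
  exact: (@integrableD _ _ _ P setT _ _ _ i1 ilZ).
have iU : P.-integrable setT (EFin \o (fun w => 1 + lam * Z w + lam ^+ 2 * B w)).
  exact: (@integrableD _ _ _ P setT _ _ _ i1Z ilB).
have le_U w : expR (lam * Z w) <= 1 + lam * Z w + lam ^+ 2 * B w.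
  apply: (le_trans (expR_le1Dx_sqr _)); rewrite lerD2l exprMn -mulrA.
  rewrite ler_wpM2l ?sqr_ge0// ler_wpM2l ?sqr_ge0// ler_expR normrM.
  by rewrite -[leRHS]mul1r ler_wpM2r.
have IU : \int[P]_w (1 + lam * Z w + lam ^+ 2 * B w) = 1 + lam ^+ 2 * \int[P]_w B w.
  rewrite RintegralD// RintegralD// Rintegral_cst//= probability_setT.
  by rewrite RintegralZl// RintegralZl// Z0 mulr0 addr0 mulr1.
rewrite expectation.unlock.
apply: (@le_trans _ _ (\int[P]_w (1 + lam * Z w + lam ^+ 2 * B w)%:E)%E).
  apply: ge0_le_integral => //.
  - apply/measurable_EFinP; apply: measurableT_comp => //; exact: measurable_funM.
  - by case/integrableP: iU.
  - by move=> w _; rewrite lee_fin.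
rewrite -[leLHS]fineK; last exact: integrable_fin_num iU.
rewrite lee_fin -/(Rintegral _ _ _) IU (le_trans _ (expR_ge1Dx _))// lerD2l.
by rewrite mulrC ler_wpM2r// sqr_ge0.
Qed.

Section tails.
Context {R : realType} {d : measure_display} {T : measurableType d}.
Variables (P : probability T R) (X : {RV P >-> R}) (n : nat).
Variable Xs : 'I_n -> {RV P >-> R}.
Hypothesis iidX : iid_samples X Xs.
Variable f : R -> R.
Hypothesis mf : measurable_fun setT f.

Let mS : measurable_fun setT (fun w => \sum_(i < n) f (Xs i w)).
Proof. by apply: measurable_sum => i; exact: measurableT_comp. Qed.

Lemma subgaussian_tail (A t : R) :
  P.-integrable setT (EFin \o (f \o X)) -> \int[P]_w f (X w) = 0 ->
  P.-integrable setT (EFin \o (fun w => f (X w) ^+ 2 * expR `|f (X w)|)) ->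
  \int[P]_w (f (X w) ^+ 2 * expR `|f (X w)|) <= A ->
  0 < A -> 0 < t -> t <= 2 * A ->
  (P [set w | (n%:R * t <= `|\sum_(i < n) f (Xs i w)|)%R]
    <= (2 * expR (- (n%:R * (t ^+ 2 / (4 * A)))))%:E)%E.
Proof.
move=> iZ Z0 iZ2 ZA A0 t0 tA.
(* This minimizes [A * lam ^+ 2 - lam * t]; the hypothesis [t <= 2 * A] is what keeps it at most
   1. *)
pose lam := t / (2 * A).
have lam0 : 0 < lam by rewrite divr_gt0// mulr_gt0.
have lam1 : lam <= 1 by rewrite ler_pdivrMr ?mul1r// mulr_gt0.
(* Stated for both signs of [s], to serve the upper and the lower tail. *)
have tail s : `|s| = lam ->
    (P [set w | (n%:R * (lam * t) <= \sum_(i < n) s * f (Xs i w))%R]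
      <= (expR (- (n%:R * (t ^+ 2 / (4 * A)))))%:E)%E.
  move=> slam.
  have s2 : s ^+ 2 = lam ^+ 2 by rewrite -slam real_normK ?num_real.
  have := @centered_mgf_le _ _ _ P (f \o X) A s iZ Z0 iZ2 ZA.
  rewrite slam => /(_ lam1) mgf.
  have ms : measurable_fun setT (fun x => s * f x) by exact: measurable_funM.
  apply: (le_trans (iid_chernoff _ _ _ _ iidX (fun x => s * f x) _ _ ms mgf)).
  rewrite lee_fin -expRM_natl -expRD ler_expR s2 /lam.
  suff -> : - (n%:R * (t / (2 * A) * t)) + n%:R * (A * (t / (2 * A)) ^+ 2) =
    - (n%:R * (t ^+ 2 / (4 * A))) by [].
  by field; rewrite gt_eqF.
have mtail s : measurable [set w | n%:R * (lam * t) <= \sum_(i < n) s * f (Xs i w)].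
  under eq_set do rewrite -mulr_sumr.
  rewrite -[X in measurable X]setTI; apply: measurable_fun_le => //.
  exact: measurable_funM.
have sumE s w : \sum_(i < n) s * f (Xs i w) = s * \sum_(i < n) f (Xs i w).
  by rewrite mulr_sumr.
apply: (@le_trans _ _ (P ([set w | n%:R * (lam * t) <= \sum_(i < n) lam * f (Xs i w)]
   `|` [set w | n%:R * (lam * t) <= \sum_(i < n) - lam * f (Xs i w)]))).
  apply: le_measure; rewrite ?inE.
  - rewrite -[X in measurable X]setTI; apply: measurable_fun_le => //.
    exact: measurableT_comp.
  - exact: measurableU.
  - move=> w /=; rewrite !sumE mulrCA mulNr -mulrN !ler_pM2l//.
    by rewrite ler_normr => /orP.
apply: (le_trans (measureU2 _ _ _)) => //.
have twice (x : R) : (2 * x)%:E = (x%:E + x%:E)%E.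
  by rewrite -EFinD; congr EFin; ring.
by rewrite twice leeD// tail// ?normrN gtr0_norm.
Qed.

(** On the event the mean of the |X i| is at least t - m >= t/2, so [powR_sum_ge] bounds the mean of
    the |X i|^b from below. Chernoff's bound then costs a factor top^n, and the remaining lower
    bounds on [t] let half of the exponent absorb it. *)
Lemma power_tail (b c top m t : R) :
  ('E_P[fun w => expR (c * `|X w| `^ b)%R] < top%:E)%E ->
  1 < b -> 0 < c -> (forall x, `|f x| <= `|x| + m) ->
  2 <= t -> 2 * m <= t -> 4 * (top / c) <= t ->
  (P [set w | (n%:R * t <= `|\sum_(i < n) f (Xs i w)|)%R]
    <= (expR (- (n%:R * (c / 2 * 2^-1 `^ b * t `^ b))))%:E)%E.
Proof.
move=> Xtop b1 c0 fm t2 tm tc.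
have t_half : (t / 2) `^ b = 2^-1 `^ b * t `^ b.
  by rewrite mulrC powRM// (le_trans _ t2).
have mh : measurable_fun setT (fun x : R => c * `|x| `^ b).
  apply: measurable_funM => //.
  exact: (measurableT_comp (measurable_powR _)).
have ms : measurable_fun setT (fun w => \sum_(i < n) c * `|Xs i w| `^ b).
  by apply: measurable_sum => i; exact: (measurableT_comp mh).
apply: (@le_trans _ _
    (P [set w | n%:R * (c * (t / 2) `^ b) <= \sum_(i < n) c * `|Xs i w| `^ b])).
  apply: le_measure; rewrite ?inE.
  - rewrite -[X in measurable X]setTI; apply: measurable_fun_le => //.
    exact: measurableT_comp.
  - by rewrite -[X in measurable X]setTI; exact: measurable_fun_le.
  - move=> w /= nt; rewrite -mulr_sumr mulrCA ler_pM2l//.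
    apply: powR_sum_ge => //; first by rewrite divr_gt0// (lt_le_trans _ t2).
    have : `|\sum_(i < n) f (Xs i w)| <= \sum_(i < n) (`|Xs i w| + m).
      by rewrite (le_trans (ler_norm_sum _ _ _))// ler_sum.
    rewrite big_split/= sumr_const card_ord -mulr_natl.
    have : n%:R * (2 * m) <= n%:R * t by rewrite ler_wpM2l.
    lra.
apply: (le_trans (iid_chernoff _ _ _ _ iidX (fun x => c * `|x| `^ b) _ _ mh (ltW Xtop))).
have top_exp : top <= expR top.
  by rewrite (le_trans _ (expR_ge1Dx _))// lerDr.
have top0 : 0 <= top.
  rewrite -lee_fin (le_trans _ (ltW Xtop))//; apply: expectation_ge0 => w.
  exact: expR_ge0.
rewrite lee_fin.
have : top ^+ n <= expR top ^+ n by rewrite lerXn2r// nnegrE ?expR_ge0.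
move=> /(ler_wpM2l (expR_ge0 (- (n%:R * (c * (t / 2) `^ b)))))/le_trans; apply.
rewrite -expRM_natl -expRD ler_expR.
(* As t/2 >= 1, the power exceeds t/2; with 4 top <= c t this puts [top] below half of c (t/2)^b. *)
have t1 : t / 2 <= (t / 2) `^ b.
  by rewrite -[leLHS]powRr1 ?ler_powR ?(ltW b1)//; lra.
have : top <= c / 2 * (t / 2) `^ b.
  have : c * (4 * (top / c)) <= c * t by rewrite ler_pM2l.
  rewrite mulrCA (mulrC c) divfK ?gt_eqF// => h.
  have : c * (t / 2) <= c * (t / 2) `^ b by rewrite ler_pM2l.
  lra.
move=> /(ler_wpM2l (ler0n R n)).
by rewrite t_half; lra.
Qed.

End tails.

(** * The sample problem *)

Section sample_problem.
Context {R : realType}.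
Variables (l : R -> R) (k K : R).
Hypotheses (k0 : 0 < k) (K0 : 0 < K).
Hypothesis lK : forall x y, `|l x - l y| <= K * `|x - y|.
Hypothesis lk : forall x y : R, x <= y -> l x + k * (y - x) <= l y.
Variable n : nat.
Hypothesis n0 : (0 < n)%N.

Definition sample_loss (x : 'I_n -> R) (xi : R) : R :=
  n%:R^-1 * (\sum_(i < n) l (x i - xi)).

Variable x : 'I_n -> R.

Let sample_lossB xi xi' : sample_loss x xi - sample_loss x xi' =
  n%:R^-1 * \sum_(i < n) (l (x i - xi) - l (x i - xi')).
Proof. by rewrite /sample_loss -mulrBr sumrB. Qed.

Let average_cst (a : R) : a = n%:R^-1 * \sum_(i < n) a.
Proof.
by rewrite sumr_const card_ord -[a *+ n]mulr_natl mulrA mulVf ?mul1r// pnatr_eq0 -lt0n.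
Qed.

Lemma sample_loss_lower xi xi' : xi <= xi' ->
  k * (xi' - xi) <= sample_loss x xi - sample_loss x xi'.
Proof.
move=> h; rewrite sample_lossB [leLHS]average_cst ler_wpM2l ?invr_ge0//.
apply: ler_sum => i _.
have := @lk (x i - xi') (x i - xi); rewrite lerD2l lerN2 => /(_ h); lra.
Qed.

Lemma sample_loss_upper xi xi' : xi <= xi' ->
  sample_loss x xi - sample_loss x xi' <= K * (xi' - xi).
Proof.
move=> h; rewrite sample_lossB [leRHS]average_cst ler_wpM2l ?invr_ge0//.
apply: ler_sum => i _; rewrite (le_trans (ler_norm _))// (le_trans (lK _ _))//.
have -> : x i - xi - (x i - xi') = xi' - xi by ring.
by rewrite ger0_norm// subr_ge0.
Qed.

(** The root of the sample loss is the least feasible point, hence the unique solution, and [xget]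
    must return it. *)
Lemma sample_loss_saa_ubsr alpha : sample_loss x (saa_ubsr l alpha x) = alpha.
Proof.
have [r ra] := slope_root _ _ _ k0 sample_loss_lower alpha sample_loss_upper.
have feasE xi : saa_feasible l alpha x xi <-> r <= xi.
  by rewrite -(slope_le _ _ k0 sample_loss_lower) ra.
suff -> : saa_ubsr l alpha x = r by [].
apply: xget_unique => [|y [yfeas ymin]].
  by split => [|xi]; [exact/feasE|move/feasE].
by apply/eqP; rewrite eq_le ymin/=; [exact/feasE|exact/feasE].
Qed.

(* This makes the deviation event measurable, although [saa_ubsr] is defined
   through [xget]. *)
Lemma saa_ubsr_distE alpha r eps :
  (eps < `|saa_ubsr l alpha x - r|) =
  (alpha < sample_loss x (r + eps)) || (sample_loss x (r - eps) < alpha).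
Proof.
rewrite -{2 3}(sample_loss_saa_ubsr alpha).
rewrite !(slope_lt _ _ k0 sample_loss_lower) ltr_normr.
by congr (_ || _); apply/idP/idP; lra.
Qed.

(** If the sample root lies beyond r + eps, the sample loss there still exceeds [alpha], and going
    back to [r] adds at least k eps; the other side is symmetric. *)
Lemma saa_ubsr_dist_le alpha r eps : 0 < eps ->
  eps < `|saa_ubsr l alpha x - r| ->
  n%:R * (k * eps / K) <= `|\sum_(i < n) (l (x i - r) - alpha) / K|.
Proof.
move=> eps0; rewrite saa_ubsr_distE => h.
have nE : \sum_(i < n) (l (x i - r) - alpha) / K =
    n%:R / K * (sample_loss x r - alpha).
  rewrite -mulr_suml sumrB sumr_const card_ord -[alpha *+ n]mulr_natl.
  rewrite /sample_loss; field.
  by rewrite !gt_eqF ?ltr0n.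
have n_gt0 : (0 : R) < n%:R by rewrite ltr0n.
have nK : 0 < n%:R / K by rewrite divr_gt0.
rewrite nE normrM (gtr0_norm nK) mulrA mulrAC ler_pM2l// ler_normr.
have h1 := @sample_loss_lower r (r + eps).
have h2 := @sample_loss_lower (r - eps) r.
have {}h1 : k * eps <= sample_loss x r - sample_loss x (r + eps).
  by have := h1 (ltW _); rewrite ltrDl addrAC subrr add0r; apply.
have {}h2 : k * eps <= sample_loss x (r - eps) - sample_loss x r.
  have := h2 (ltW _); rewrite gtrBl opprB addrC subrK; exact.
by case/orP: h => h; apply/orP; [left|right]; lra.
Qed.

End sample_problem.

(** * Choice of constants and comparison of the rates *)

Theorem proposition32 (R : realType) (beta gamma top : R)
    (beta_gt1 : 1 < beta) (gamma_gt0 : 0 < gamma) (top_gt0 : 0 < top) :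
  exists c1 c2 c3 : R, [/\ 0 < c1, 0 < c2 & 0 < c3] /\
  forall (d : measure_display) (T : measurableType d) (P : probability T R)
    (X : {RV P >-> R}) (alpha : R) (l : R -> R) (K k : R),
  ('E_P[fun w => expR (gamma * `|X w| `^ beta)%R] < top%:E)%E ->
  {homo l : x y / x <= y} ->
  0 < K -> 0 < k ->
  K.-lipschitz l ->
  (forall x1 x2 : R, x1 <= x2 -> l x1 + k * (x2 - x1) <= l x2) ->
  forall (eps : R) (n : nat) (Xs : 'I_n -> {RV P >-> R}),
  0 < eps -> (1 <= n)%N ->
  iid_samples X Xs ->
  (P [set w | (eps < `|saa_ubsr l alpha (fun i => Xs i w) - ubsr P l alpha X|)%R]
   <= (c1 * (expR (- (c2 * n%:R * (k * eps / K) ^+ 2)) * (eps <= K / k)%R%:R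
           + expR (- (c3 * n%:R * (k * eps / K) `^ beta)) * (K / k < eps)%R%:R))%:E)%E.
Proof.
have [C C0 XC] := linear_le_powR beta gamma beta_gt1 gamma_gt0.
pose M := expR C * top.
(* [M] bounds E|X|; the three summands of [t0] meet the three lower bounds on [t] in
   [power_tail]. *)
pose t0 := 2 + 2 * M + 4 * (top / gamma).
(* The first summand bounds E[Z^2 e^|Z|]; adding [t0] ensures t <= 2A whenever t <= t0. *)
pose A := 4 * expR (2 * M + C) * top + t0.
pose q := gamma / 2 * 2^-1 `^ beta.
(* For 1 < t <= t0, t^2 >= 1 >= (t / t0)^beta, so t^2 / (4A) is at least q' t^beta. *)
pose q' := (4 * A * t0 `^ beta)^-1.
have M0 : 0 < M by rewrite mulr_gt0 ?expR_gt0.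
have tg0 : 0 < top / gamma by rewrite divr_gt0.
have t0_ge2 : 2 <= t0 by rewrite /t0; lra.
have t0_gt0 : 0 < t0 by lra.
have A1 : 4 * expR (2 * M + C) * top <= A by rewrite /A; lra.
have A0 : 0 < A by rewrite ltr_wpDl// !mulr_ge0 ?expR_ge0 ?ltW.
have q0 : 0 < q by rewrite mulr_gt0 ?powR_gt0 ?divr_gt0 ?invr_gt0.
have q'0 : 0 < q' by rewrite invr_gt0 !mulr_gt0 ?powR_gt0.
(* The 2 counts the two subgaussian tails; the minimum covers the ranges 1 < t <= t0 and t > t0
   together. *)
exists 2, (4 * A)^-1, (Num.min q q'); split.
  by split; rewrite ?invr_gt0 ?mulr_gt0// lt_min q0.
move=> d T P X alpha l K k Xtop _ K0 k0 /klipschitzP lK lk eps n Xs eps0 n1 iidX.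
have [r ra] := mean_loss_root P X beta gamma top Xtop C XC l k K k0 K0 lK lk alpha.
rewrite (ubsr_mean_loss P X beta gamma top Xtop C XC l k K k0 K0 lK lk r alpha ra).
pose t := k * eps / K.
have t_gt0 : 0 < t by rewrite divr_gt0// mulr_gt0.
have t_le1 : (eps <= K / k) = (t <= 1).
  by rewrite ler_pdivrMr// ler_pdivlMr// mul1r mulrC.
pose Z := centered_loss P X l K r.
have mZ : measurable_fun setT Z by exact: measurable_centered_loss lK r.
pose S := [set w | n%:R * t <= `|\sum_(i < n) Z (Xs i w)|].
have mS : measurable S.
  rewrite /S -[X in measurable X]setTI; apply: measurable_fun_le => //.
  apply: measurableT_comp => //; apply: measurable_sum => i.
  exact: measurableT_comp.
have ml xi : measurable_fun setT (fun w => sample_loss l n (fun i => Xs i w) xi).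
  apply: measurable_funM => //; apply: measurable_sum => i.
  apply: (@measurableT_comp _ _ _ _ _ _ l).
    by apply: continuous_measurable_fun; exact: lipschitz_continuous lK.
  exact: measurable_funB.
have mlt (f g : T -> R) : measurable_fun setT f -> measurable_fun setT g ->
    measurable [set w | f w < g w].
  move=> mf mg; have := measurable_fun_ltr mf mg measurableT (Logic.I : measurable [set true]).
  by rewrite setTI.
set E := [set w | _].
have mE : measurable E.
  rewrite (_ : E = [set w | alpha < sample_loss l n (fun i => Xs i w) (r + eps)] `|`
                   [set w | sample_loss l n (fun i => Xs i w) (r - eps) < alpha]).
    by apply: measurableU; apply: mlt.
  apply/seteqP; split=> w;
    rewrite /E /= (saa_ubsr_distE _ _ _ k0 lK lk n n1); first by move/orP.
  by move=> h; apply/orP.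
have ES : (P E <= P S)%E.
  apply: le_measure; rewrite ?inE// => w Ew.
  have := saa_ubsr_dist_le l k K k0 K0 lK lk n n1 _ alpha r eps eps0 Ew.
  by rewrite /S/= /Z /centered_loss ra.
apply: (le_trans ES).
have small : t <= t0 -> (P S <= (2 * expR (- (n%:R * (t ^+ 2 / (4 * A)))))%:E)%E.
  move=> tt0.
  have Zm w := normr_centered_loss P X beta gamma top Xtop C XC l K K0 lK r (X w).
  have mZX : measurable_fun setT (Z \o X) by exact: measurableT_comp.
  have [iZ2 Z2] := sqr_expR_moment P X beta gamma top Xtop C XC (Z \o X) mZX Zm.
  apply: (subgaussian_tail _ _ _ _ iidX Z mZ A t) => //.
  - exact: (integrable_centered_loss P X beta gamma top Xtop C XC l K K0 lK r).
  - exact: (Rintegral_centered_loss P X beta gamma top Xtop C XC l K K0 lK r).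
  - exact: le_trans Z2 A1.
  - have : 0 <= 4 * expR (2 * M + C) * top by rewrite !mulr_ge0 ?expR_ge0 ?ltW.
    rewrite /A; lra.
have large : t0 < t -> (P S <= (expR (- (n%:R * (q * t `^ beta))))%:E)%E.
  move=> t0t.
  have [_ mM] := first_absolute_moment P X beta gamma top Xtop C XC.
  apply: (power_tail _ _ _ _ iidX Z mZ beta gamma top _ t Xtop) => //.
  - by move=> x; exact: (normr_centered_loss P X beta gamma top Xtop C XC l K K0 lK r x).
  - by move: t0t; rewrite /t0; lra.
  - by move: mM t0t; rewrite /t0 -/M; lra.
  - by move: t0t; rewrite /t0; lra.
rewrite -/t ltNge t_le1; case: (leP t 1) => t1 /=; rewrite ?(mulr0, mulr1, addr0, add0r).
  have tt0 : t <= t0 by lra.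
  apply: (le_trans (small tt0)); rewrite lee_fin ler_pM2l// ler_expR lerN2.
  suff -> : (4 * A)^-1 * n%:R * t ^+ 2 = n%:R * (t ^+ 2 / (4 * A)) by [].
  by field; rewrite gt_eqF.
have tb0 : 0 <= t `^ beta by rewrite powR_ge0.
(* Up to [t0] the subgaussian bound is still the one used, with its exponent weakened to the power
   rate. *)
have [tt0|t0t] := leP t t0.
  apply: (le_trans (small tt0)); rewrite lee_fin ler_pM2l// ler_expR lerN2.
  rewrite mulrAC mulrC ler_wpM2l//.
  apply: (@le_trans _ _ (q' * t `^ beta)).
    by rewrite ler_wpM2r// ge_min lexx orbT.
  have : t `^ beta <= t0 `^ beta.
    by rewrite ge0_ler_powR ?nnegrE ?(ltW t_gt0) ?(ltW t0_gt0)//; lra.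
  have : 1 <= t ^+ 2 by rewrite expr_ge1// ltW.
  move=> h1 h2; rewrite /q' invfM -mulrA [leRHS]mulrC ler_pM2l ?invr_gt0 ?mulr_gt0//.
  by rewrite (le_trans _ h1)// mulrC ler_pdivrMr ?powR_gt0// mul1r.
apply: (le_trans (large t0t)); rewrite lee_fin.
apply: (@le_trans _ _ (expR (- (Num.min q q' * n%:R * t `^ beta)))).
  rewrite ler_expR lerN2 mulrAC mulrC ler_wpM2l// ler_wpM2r//.
  by rewrite ge_min lexx.
by rewrite ler_peMl ?expR_ge0// ler1n.
Qed.
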